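(* Assume that $1<c<2$ and let $m\ge 2$ be an integer. Let $L_k$ denote the subword complexity of the sequence $(\lfloor n^c\rfloor \bmod m)_{n\ge 0}$. There exists a constant $C_1$ such that $L_k\le C_1 k^r$ for all $k\ge 1$, for all $r>\max\{4/(2-c),6\}$. Moreover, there is a constant $C_2>0$ such that $L_k\ge C_2 k^3$ for all $k\ge1$.
   Context: For a sequence $u$ with values in $\{0,1,\ldots,m-1\}$ and a positive integer $k$, the subword complexity $L_k$ is the number of distinct blocks $B\in\{0,\ldots,m-1\}^k$ that occur as a contiguous subsequence $(u_n,u_{n+1},\ldots,u_{n+k-1})$ of $u$. *)

(* Defs.v *)
From HB Require Import structures.
From mathcomp Require Import all_boot all_order all_algebra.
From mathcomp Require Import boolp classical_sets reals exp.
Set Implicit Arguments. Unset Strict Implicit. Unset Printing Implicit Defensive.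
Import Order.TTheory GRing.Theory Num.Theory.

Definition subword_complexity (m : nat) (u : nat -> nat) (k : nat) : nat :=
  #| [set B : {ffun 'I_k -> 'I_m} |
       `[< exists n : nat, forall i : 'I_k, val (B i) = u (n + val i) >] ] |.

Local Open Scope ring_scope.

(* The sequence (floor(n^c) mod m)_{n >= 0}; n^c >= 0 so truncn is the floor,
   and powR gives 0 `^ c = 0 for c <> 0. *)
Definition floor_pow_mod (R : realType) (c : R) (m : nat) (n : nat) : nat :=
  (Num.truncn ((n%:R : R) `^ c) %% m)%N.

(* Main.v *)
(** Of the sequence n^c only this is used: its first differences tend to
    infinity, and its second differences are nonnegative and tend to 0.

    Upper bound. Once the second differences are below k^-3, a window g of
    length k is convex and so close to affine that (y - x)(g z - g y) exceeds
    (z - y)(g y - g x) by at most 1 whenever x < y < z. Subtract from g its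
    value at an index i1 of least fractional part. On either side of i1 the
    floors u d, at distance d from i1, are then determined by the first
    maximiser e of u d / d and the value u e, and modulo m only u e mod (m e)
    matters. This leaves O(k^5) words. As the second differences are at most
    4 n^(c - 2), only O(k^(3 / (2 - c))) windows start too early for this, and
    they contribute at most one word each.

    Lower bound. For a rational slope p/q and any a, some n makes the word at n
    equal to that of the line (a + i p)/q: far out there are arbitrarily long
    windows on which the first differences stay in [v + rho, v + 2 rho], where
    v = p/q modulo m; sampling such a window with step m q, the values move
    modulo m upwards by small steps through a whole period, so one of them falls
    just above a/q. Distinct triples (p, q, a) with p/q reduced, p, a < q <= k/2
    give distinct words, and the sum of q phi(q) over q <= K is at least
    K^3/64. *)

Require Import Defs.
From mathcomp Require Import all_boot all_order all_algebra.
From mathcomp Require Import boolp classical_sets reals exp.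
From mathcomp Require Import topology normedtype sequences derive cyclic.
From mathcomp Require Import zify ring lra.
Set Implicit Arguments.
Unset Strict Implicit.
Unset Printing Implicit Defensive.
Import Order.TTheory GRing.Theory Num.Theory numFieldNormedType.Exports.
Local Open Scope ring_scope.

(** * First differences and floors *)

Lemma telescope_addn (V : zmodType) (f : nat -> V) (n : nat) :
  telescope (fun i => f (n + i)%N) = fun i => telescope f (n + i)%N.
Proof. by apply/funext => i; rewrite /telescope /= addnS. Qed.

Lemma increment_bounds (R : numDomainType) (f : nat -> R) (lo hi : R)
    (m n : nat) : (m <= n)%N ->
  (forall i, (m <= i < n)%N -> lo <= telescope f i <= hi) ->
  lo * (n - m)%:R <= f n - f m <= hi * (n - m)%:R.
Proof.
move=> mn dfi; rewrite -(telescope_sumr f mn) !mulr_natr -!sumr_const_nat.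
by apply/andP; split; apply: ler_sum_nat => i /dfi /andP[].
Qed.

Lemma discrete_IVT (R : realDomainType) (h : nat -> R) (T eps : R) (J : nat) :
  0 <= eps -> h 0%N <= T <= h J ->
  (forall j, (j < J)%N -> h j.+1 <= h j + eps) ->
  exists2 j, (j <= J)%N & T <= h j <= T + eps.
Proof.
move=> eps0 /andP[h0T TJ] step.
have crossed : exists j, T <= h j by exists J.
case: (ex_minnP crossed) => j Tj jmin; have jJ := jmin _ TJ.
exists j => //; rewrite Tj /=; case: j Tj jmin jJ => [|j] _ jmin jJ.
  by rewrite (le_trans h0T) // lerDl.
apply: le_trans (step _ jJ) _; rewrite lerD2r leNgt.
by apply/negP => /ltW /jmin; rewrite ltnn.
Qed.

Lemma discrete_IVT_mod (R : archiRealFieldType) (h : nat -> R)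
    (m t eps : R) (J : nat) : 0 < m -> 0 <= eps -> h 0%N + m <= h J ->
  (forall j, (j < J)%N -> h j.+1 <= h j + eps) ->
  exists2 j, (j <= J)%N &
    exists z : int, t + m * z%:~R <= h j <= t + m * z%:~R + eps.
Proof.
move=> m0 eps0 rise step; pose z := Num.ceil ((h 0%N - t) / m).
have [|j jJ hj] := discrete_IVT (T := t + m * z%:~R) eps0 _ step; last first.
  by exists j => //; exists z.
have /andP[zlt zge] : (z - 1)%:~R * m < h 0%N - t <= z%:~R * m.
  by rewrite -ltr_pdivlMr // -ler_pdivrMr // ceil_itv.
by move: zlt zge; rewrite intrB; lra.
Qed.

Definition floor_mod (R : archiRealFieldType) (m : nat) (x : R) : nat :=
  `|(Num.floor x %% m)%Z|%N.

Lemma floor_modE (R : archiRealFieldType) (m : nat) (x : R) : (0 < m)%N ->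
  (floor_mod m x)%:Z = (Num.floor x %% m)%Z.
Proof. by move=> m0; rewrite gez0_abs // modz_ge0 // -lt0n. Qed.

Lemma floor_mod_lt (R : archiRealFieldType) (m : nat) (x : R) : (0 < m)%N ->
  (floor_mod m x < m)%N.
Proof. by move=> m0; rewrite -ltz_nat floor_modE // ltz_pmod. Qed.

Lemma floor_modBz (R : archiRealFieldType) (m : nat) (x : R) (z : int) :
  floor_mod m (x - m%:R * z%:~R) = floor_mod m x.
Proof.
rewrite /floor_mod pmulrn -intrM -mulrNz floorDrz ?intr_int // intrKfloor.
by rewrite mulrC -mulNr addrC modzMDl.
Qed.

(** * Subword complexity and words of lines *)

Lemma subword_complexity_leq_card (T : finType) (m k N : nat) (u : nat -> nat)
    (w : T -> nat -> nat) : (0 < m)%N ->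
  (forall n, (N <= n)%N ->
     exists t, forall i, (i < k)%N -> u (n + i)%N = w t i) ->
  (subword_complexity m u k <= N + #|T|)%N.
Proof.
move=> m0 code.
pose block (v : nat -> nat) : {ffun 'I_k -> 'I_m} :=
  [ffun i : 'I_k => Ordinal (ltn_pmod (v i) m0)].
pose early := [set block (fun i => u (n + i)%N) | n : 'I_N].
pose coded := [set block (w t) | t : T].
have sub : (subword_complexity m u k <= #|early :|: coded|)%N.
  apply/subset_leq_card/fintype.subsetP => B /[!inE] -[n Bn].
  have Bblock v : (forall i, (i < k)%N -> u (n + i)%N = v i) -> B = block v.
    move=> uv; apply/ffunP => i; apply/val_inj.
    by rewrite ffunE /= -uv // -Bn modn_small ?ltn_ord.
  apply/orP; have [nN|Nn] := ltnP n N; [left|right]; apply/imsetP.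
    by exists (Ordinal nN) => //; exact: Bblock.
  by have [t ut] := code n Nn; exists t => //; exact: Bblock.
apply: leq_trans sub (leq_trans (leq_card_setU _ _) (leq_add _ _)).
  by rewrite -[X in (_ <= X)%N](card_ord N) leq_imset_card.
exact: leq_imset_card.
Qed.

Lemma card_leq_subword_complexity (T : finType) (S : {set T}) (m k : nat)
    (u : nat -> nat) (w : T -> nat -> nat) : (forall n, (u n < m)%N) ->
  {in S, forall t, exists n, forall i, (i < k)%N -> u (n + i)%N = w t i} ->
  {in S &, forall t t', (forall i, (i < k)%N -> w t i = w t' i) -> t = t'} ->
  (#|S| <= subword_complexity m u k)%N.
Proof.
move=> um occ winj; have m0 : (0 < m)%N by exact: leq_ltn_trans (um 0%N).
pose block t : {ffun 'I_k -> 'I_m} :=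
  [ffun i : 'I_k => Ordinal (ltn_pmod (w t i) m0)].
have block_val t i : t \in S -> block t i = w t i :> nat.
  by move=> /occ[n un]; rewrite ffunE /= -un // modn_small.
rewrite -(card_in_imset (f := block)) => [|t t' tS t'S /ffunP eqb].
  apply/subset_leq_card/fintype.subsetP => _ /imsetP[t tS ->].
  rewrite inE; apply/asboolP; have [n un] := occ t tS.
  by exists n => i; rewrite un ?ltn_ord //; exact: block_val.
apply: winj => // i ik.
by rewrite -!(block_val _ (Ordinal ik)) // eqb.
Qed.

Lemma subword_complexity_gt0 (m k : nat) (u : nat -> nat) :
  (forall n, (u n < m)%N) -> (0 < subword_complexity m u k)%N.
Proof.
move=> um; rewrite -card_unit -cardsT.
apply: (card_leq_subword_complexity (w := fun=> u)) => // [[] _|[] []//].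
by exists 0%N.
Qed.

Lemma progression_dvdn (p q a x : nat) : (0 < q)%N -> coprime q p ->
  exists2 i, (x <= i < x + q)%N & (q %| a + i * p)%N.
Proof.
move=> q0 /eqP qp; have [u _] := Bezoutl p q0; rewrite qp => qu.
exists (x + (u * (a + x * p)) %% q)%N.
  by rewrite leq_addr ltn_add2l ltn_mod.
rewrite mulnDl addnA /dvdn -modnDmr modnMml modnDmr.
rewrite (_ : _ + _ = (1 + u * p) * (a + x * p))%N; last by ring.
exact: dvdn_mulr.
Qed.

Lemma coprime_frac_inj (p q p' q' : nat) : (0 < q)%N -> coprime q p ->
  coprime q' p' -> (q' * p = q * p')%N -> p = p' /\ q = q'.
Proof.
move=> q0 cop cop' eqf.
have eqq : q = q'.
  apply/eqP; rewrite eqn_dvd -(Gauss_dvdl q' cop) eqf dvdn_mulr //=.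
  by rewrite -(Gauss_dvdl q cop') -eqf dvdn_mulr.
by split=> //; apply/eqP; rewrite -(eqn_pmul2l q0) {1}eqq eqf.
Qed.

Lemma unit_steps_mod_inj (m k : nat) (u v : nat -> nat) : (2 <= m)%N ->
  u 0%N = v 0%N ->
  (forall i, (u i <= u i.+1 <= (u i).+1)%N) ->
  (forall i, (v i <= v i.+1 <= (v i).+1)%N) ->
  (forall i, (i < k)%N -> u i = v i %[mod m]) ->
  forall i, (i < k)%N -> u i = v i.
Proof.
move=> m2 uv0 ustep vstep uvm; elim=> [//|i uvi] ik.
have := uvm _ ik; have := ustep i; have := vstep i; rewrite -uvi ?(ltnW ik) //.
have eq_mod1 d d' : (d <= 1)%N -> (d' <= 1)%N ->
    u i + d = u i + d' %[mod m] -> d = d'.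
  by move=> d1 d1' /eqP; rewrite eqn_modDl !modn_small; [move/eqP | lia..].
move=> vi ui eqm; suff : (u i.+1 - u i = v i.+1 - u i)%N by lia.
by apply: eq_mod1; rewrite ?subnKC //; lia.
Qed.

Definition discrete_line (p q a i : nat) : nat := (a + i * p) %/ q.

Lemma discrete_line0 (p q a : nat) : (a < q)%N -> discrete_line p q a 0 = 0%N.
Proof. by rewrite /discrete_line addn0; exact: divn_small. Qed.

Lemma discrete_lineS (p q a i : nat) : (p <= q)%N ->
  (discrete_line p q a i <= discrete_line p q a i.+1 <=
     (discrete_line p q a i).+1)%N.
Proof.
rewrite /discrete_line mulSn addnCA; case: q => [|q] pq.
  by rewrite !divn0.
rewrite leq_div2r ?leq_addl //=.
have -> : ((a + i * p) %/ q.+1).+1 = ((a + i * p + q.+1) %/ q.+1)%N.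
  by rewrite [RHS]divnDr // divnn addn1.
by rewrite leq_div2r // addnC leq_add2l.
Qed.

Lemma discrete_line_slopeD (p q a n i : nat) : (0 < q)%N ->
  discrete_line (p + q * n) q a i = (discrete_line p q a i + i * n)%N.
Proof.
move=> q0; rewrite /discrete_line mulnDr addnA mulnCA divnDr ?dvdn_mulr //.
by rewrite mulKn.
Qed.

(* At a lattice point of the first line its floor is exact, whereas the floor of
   the second line only bounds that line from below. *)
Lemma discrete_line_touch (p q a p' q' a' x K : nat) : (0 < q)%N ->
  (q <= K)%N -> coprime q p ->
  (forall i, (i < x + K)%N ->
     discrete_line p q a i = discrete_line p' q' a' i) ->
  exists2 i, (x <= i < x + K)%N & (q' * (a + i * p) <= q * (a' + i * p'))%N.
Proof.
move=> q0 qK cop agree; have [i xi qi] := progression_dvdn a x q0 cop.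
exists i; first by lia.
rewrite -{1}(divnK qi) [(_ %/ q)%N]agree; last by lia.
by rewrite mulnA mulnC leq_mul2l mulnC leq_divM orbT.
Qed.

Lemma discrete_line_slope_le (p q a p' q' a' K : nat) :
  (0 < q <= K)%N -> (0 < q' <= K)%N -> coprime q p -> coprime q' p' ->
  (forall i, (i < K + K)%N ->
     discrete_line p q a i = discrete_line p' q' a' i) ->
  (q' * p <= q * p')%N.
Proof.
move=> /andP[q0 qK] /andP[q'0 qK'] cop cop' agree.
have [i iK second_below] : exists2 i, (0 <= i < 0 + K)%N &
    (q * (a' + i * p') <= q' * (a + i * p))%N.
  by apply: discrete_line_touch => // i iK; rewrite agree //; lia.
have [j jK first_below] := discrete_line_touch q0 qK cop agree.
have ij : (0 < j - i)%N by lia.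
by rewrite -(leq_pmul2l ij) !mulnBl; nia.
Qed.

Lemma discrete_line_inj (p q a p' q' a' K : nat) :
  (a < q <= K)%N -> (a' < q' <= K)%N -> coprime q p -> coprime q' p' ->
  (forall i, (i < K + K)%N ->
     discrete_line p q a i = discrete_line p' q' a' i) ->
  [/\ p = p', q = q' & a = a'].
Proof.
move=> /andP[aq qK] /andP[aq' qK'] cop cop' agree.
have q0 : (0 < q)%N by exact: leq_ltn_trans aq.
have q'0 : (0 < q')%N by exact: leq_ltn_trans aq'.
have agree' i : (i < K + K)%N ->
    discrete_line p' q' a' i = discrete_line p q a i by move=> /agree.
have [eqp eqq] : p = p' /\ q = q'.
  apply: coprime_frac_inj => //; apply/anti_leq/andP; split.
    by apply: discrete_line_slope_le agree; rewrite ?q0 ?q'0.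
  by apply: discrete_line_slope_le agree'; rewrite ?q0 ?q'0.
subst p' q'; split=> //; apply/eqP; rewrite eqn_leq.
have [i _] := discrete_line_touch q0 qK cop agree.
have [j _] := discrete_line_touch q0 qK cop agree'.
by rewrite !leq_pmul2l // !leq_add2r => -> ->.
Qed.

(** * Counting reduced fractions *)

Lemma totient_leq (n : nat) : (totient n <= n)%N.
Proof.
rewrite totient_count_coprime big_mkord -[X in (_ <= X)%N]card_ord -sum1_card.
by apply: leq_sum => i _; exact: leq_b1.
Qed.

Lemma sum_totient_divn (K : nat) :
  (2 * \sum_(1 <= d < K.+1) totient d * (K %/ d) = K * K.+1)%N.
Proof.
elim: K => [|K IH]; first by rewrite big_geq.
have divS d : (0 < d)%N -> (totient d * (K.+1 %/ d) =
    (if d %| K.+1 then totient d else 0) + totient d * (K %/ d))%N.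
  by move=> d0; rewrite divnS // mulnDr; case: dvdn; rewrite ?muln1 ?muln0.
have sum_dvd : (\sum_(1 <= d < K.+2 | d %| K.+1) totient d = K.+1)%N.
  rewrite -[RHS]sum_totient_dvd -(big_mkord (dvdn^~ K.+1) totient).
  by rewrite [RHS]big_ltn_cond.
rewrite (eq_big_nat _ _ (fun d dK => divS d (proj1 (andP dK)))) big_split /=.
rewrite -big_mkcond /= sum_dvd [X in (_ + X)%N]big_nat_recr //=.
by rewrite divn_small // muln0 addn0 mulnDr IH; ring.
Qed.

Lemma sum_mul_totient_ge (K : nat) :
  (K ^ 3 <= 64 * \sum_(1 <= d < K.+1) d * totient d)%N.
Proof.
pose L := (K %/ 4)%N; have L4 : (4 * L <= K)%N by rewrite mulnC leq_divM.
have splitL (F : nat -> nat) : (\sum_(1 <= d < K.+1) F d =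
    \sum_(1 <= d < L.+1) F d + \sum_(L.+1 <= d < K.+1) F d)%N.
  by rewrite (big_cat_nat (n := L.+1)) //= ltnS leq_div.
have low : (\sum_(1 <= d < L.+1) totient d * (K %/ d) <= L * K)%N.
  rewrite -[X in (X * K)%N](subn1 L.+1) -sum_nat_const_nat.
  apply: leq_sum => d _; apply: leq_trans (leq_divM K d).
  by rewrite mulnC leq_mul2l totient_leq orbT.
have high : (K * \sum_(L.+1 <= d < K.+1) totient d * (K %/ d) <=
    16 * \sum_(L.+1 <= d < K.+1) d * totient d)%N.
  rewrite !big_distrr /= !big_nat; apply: leq_sum => d /andP[Ld _].
  have K4d : (K < 4 * d)%N by lia.
  have Kd4 : (K %/ d <= 3)%N by rewrite -ltnS ltn_divLR //; lia.
  have KKd : (K * (K %/ d) <= 16 * d)%N by have := leq_mul (leqnn K) Kd4; lia.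
  by rewrite mulnCA (mulnA 16) (mulnC _ (totient d)) leq_mul2l KKd orbT.
have := sum_totient_divn K; rewrite !splitL; move: low high.
move: (\sum_(1 <= d < _) _)%N (\sum_(1 <= d < _) _)%N => ? ?.
by move: (\sum_(_ <= d < _) _)%N (\sum_(_ <= d < _) _)%N; nia.
Qed.

Definition Farey_triples (K : nat) : {set 'I_K.+1 * 'I_K.+1 * 'I_K.+1} :=
  [set x : 'I_K.+1 * 'I_K.+1 * 'I_K.+1 |
    let: (q, p, a) := x in [&& (p < q)%N, coprime q p & (a < q)%N]].

Lemma card_Farey_triples (K : nat) :
  #|Farey_triples K| = (\sum_(1 <= q < K.+1) q * totient q)%N.
Proof.
have -> : (\sum_(1 <= q < K.+1) q * totient q =
    \sum_(q < K.+1) q * totient q)%N.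
  by rewrite -(big_mkord predT (fun q => q * totient q)%N) [RHS]big_ltn_cond.
transitivity (\sum_(q < K.+1) \sum_(p < K.+1) \sum_(a < K.+1)
    ((p < q) && coprime q p) * (a < q))%N.
  rewrite -sum1_card big_mkcond !pair_bigA /=.
  apply: eq_bigr => -[[q p] a] _; rewrite inE /=.
  by case: (p < q)%N; case: coprime; case: (a < q)%N.
apply: eq_bigr => q _; under eq_bigr do rewrite -big_distrr.
rewrite -big_distrl [RHS]mulnC /=; congr (_ * _)%N.
  rewrite totient_count_coprime big_mkord.
  rewrite (big_ord_widen K.+1 (fun p => coprime q p : nat)) 1?ltnW //.
  by rewrite [RHS]big_mkcond; apply: eq_bigr => p _; case: ltnP.
rewrite -big_mkcond /= -(big_ord_widen K.+1 (fun=> 1%N)) 1?ltnW //.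
by rewrite sum1_card card_ord.
Qed.

Lemma card_Farey_triples_leq_complexity (m k K : nat) (u : nat -> nat) :
  (2 <= m)%N -> (K + K <= k)%N -> (forall n, (u n < m)%N) ->
  (forall p q a, (p < q)%N -> exists n, forall i, (i < k)%N ->
     u (n + i)%N = (discrete_line p q a i %% m)%N) ->
  (#|Farey_triples K| <= subword_complexity m u k)%N.
Proof.
move=> m2 Kk um occ.
pose w (x : 'I_K.+1 * 'I_K.+1 * 'I_K.+1) i :=
  (discrete_line x.1.2 x.1.1 x.2 i %% m)%N.
apply: (card_leq_subword_complexity (w := w)) => //.
  by move=> [[q p] a] /[!inE] /and3P[pq _ _]; exact: occ.
move=> [[q p] a] [[q' p'] a'] /[!inE].
move=> /and3P[/= pq cop aq] /and3P[/= pq' cop' aq'] eqm.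
have agree : forall i, (i < k)%N ->
    discrete_line p q a i = discrete_line p' q' a' i.
  apply: (unit_steps_mod_inj m2) eqm => [|i|i].
  - by rewrite !discrete_line0.
  - by apply: discrete_lineS; exact: ltnW.
  - by apply: discrete_lineS; exact: ltnW.
have [|||/val_inj -> /val_inj -> /val_inj ->//] :=
    @discrete_line_inj p q a p' q' a' K _ _ cop cop'.
- by rewrite aq -ltnS ltn_ord.
- by rewrite aq' -ltnS ltn_ord.
- by move=> i iK; apply: agree; exact: leq_trans Kk.
Qed.

(** * Occurrence of the words of lines *)

Lemma exists_sample_mod (R : archiRealFieldType) (g : nat -> R)
    (m s Q J : nat) (v rho t : R) : (0 < m)%N -> 0 <= rho ->
  Q%:R * v = (m * s)%:R -> m%:R <= rho * (J * Q)%:R ->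
  (forall i, (i < J * Q)%N -> v + rho <= telescope g i <= v + 2 * rho) ->
  exists2 j, (j <= J)%N & exists z : int,
    t <= g (j * Q)%N - m%:R * z%:~R <= t + 2 * rho * Q%:R.
Proof.
move=> m0 rho0 Qv rise slope.
have incr i j : (i <= j <= J)%N -> (v + rho) * (j * Q - i * Q)%:R <=
    g (j * Q)%N - g (i * Q)%N <= (v + 2 * rho) * (j * Q - i * Q)%:R.
  move=> /andP[ij jJ]; apply: increment_bounds => [|l /andP[_ lj]].
    by rewrite leq_mul.
  by apply: slope; apply: leq_trans lj _; rewrite leq_mul.
pose h j := g (j * Q)%N - (j * (m * s))%:R.
have hE j : h j = g (j * Q)%N - (j * Q)%:R * v.
  by rewrite /h [in RHS]natrM -mulrA Qv -natrM.
have [|||j jJ|j jJ [z hz]] := @discrete_IVT_mod R h m%:R t (2 * rho * Q%:R) J.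
- by rewrite ltr0n.
- by rewrite !mulr_ge0.
- have /andP[+ _] := incr 0%N J (leqnn J).
  by move: rise; rewrite !hE mul0n subn0; lra.
- have /andP[_] := incr j j.+1 (introT andP (conj (leqnSn j) jJ)).
  by rewrite !hE mulSn addnK natrD; lra.
exists j => //; exists (z + (j * s)%N%:Z).
by move: hz; rewrite /h intrD -pmulrn mulnCA !natrM; lra.
Qed.

Lemma floor_divn (R : archiRealFieldType) (x : R) (n q : nat) : (0 < q)%N ->
  n%:R / q%:R <= x < n.+1%:R / q%:R -> Num.floor x = (n %/ q)%N.
Proof.
move=> q0 /andP[nx xn]; have qR : 0 < q%:R :> R by rewrite ltr0n.
apply: floor_def; rewrite intrD -pmulrn natr1.
apply/andP; split.
  by apply: le_trans nx; rewrite ler_pdivlMr // -natrM ler_nat leq_divM.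
apply: lt_le_trans xn _; rewrite ler_pdivrMr // -natrM ler_nat.
by rewrite ltn_ceil.
Qed.

Lemma floor_near_line (R : archiRealFieldType) (g : nat -> R)
    (p q a k : nat) (delta eps : R) : (0 < q)%N -> 0 <= eps ->
  a%:R / q%:R <= g 0%N <= a%:R / q%:R + delta ->
  (forall i, (i < k)%N -> p%:R / q%:R <= telescope g i <= p%:R / q%:R + eps) ->
  delta + eps * k%:R < q%:R^-1 ->
  forall i, (i < k)%N -> Num.floor (g i) = discrete_line p q a i.
Proof.
move=> q0 eps0 /andP[ag ga] slope small i ik; apply: floor_divn => //.
have /andP[lo hi] := increment_bounds (f := g) (leq0n i)
  (fun j ji => slope j (ltn_trans (proj2 (andP ji)) ik)).
have : eps * i%:R <= eps * k%:R by rewrite ler_wpM2l // ler_nat ltnW.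
move: lo hi small; rewrite subn0 -natr1 !natrD natrM.
by rewrite !mulrDl div1r; lra.
Qed.

Section SlowlyVaryingDifferences.
Variables (R : realType) (f : nat -> R).
Hypotheses (dfy : (telescope f n @[n --> \oo] --> +oo)%classic)
  (d2f0 : (telescope (telescope f) n @[n --> \oo] --> 0)%classic).

Lemma exists_slope_window (W : nat) (rho : R) : 0 < rho ->
  exists V : R, forall v, V <= v -> exists n, forall i, (i < W)%N ->
    v + rho <= telescope f (n + i)%N <= v + 2 * rho.
Proof.
move=> rho0; pose eps := rho / (2 * W.+1%:R).
have eps0 : 0 < eps by rewrite divr_gt0 ?mulr_gt0.
have epsW : eps * W.+1%:R = rho / 2.
  by rewrite /eps invfM mulrA mulfVK // pnatr_eq0.
have /cvgr0Pnorm_le/(_ _ eps0)[N _ d2fN] := d2f0.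
have d2f n : (N <= n)%N -> - eps <= telescope (telescope f) n <= eps.
  by move=> /d2fN; rewrite /= ler_norml.
exists (telescope f N) => v Nv; pose T := v + 3 / 2 * rho.
have /cvgryPge/(_ T)[J _ fJ] := dfy.
have [|j _|j _ /andP[Tj jT]] :=
    @discrete_IVT _ (fun j => telescope f (N + j)%N) T eps J (ltW eps0).
- by rewrite addn0 (fJ _ (leq_addl N J)) andbT /T; lra.
- have := d2f (N + j)%N (leq_addr _ _).
  by rewrite addnS ![telescope (telescope f) _]/telescope /=; lra.
exists (N + j)%N => i iW.
have /andP[lo hi] := increment_bounds (f := telescope f) (leq_addr i (N + j))
  (fun l jl => d2f l (leq_trans (leq_addr _ _) (proj1 (andP jl)))).
have : eps * i.+1%:R <= eps * W.+1%:R.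
  by rewrite ler_wpM2l ?(ltW eps0) // ler_nat ltnW.
by move: Tj jT lo hi; rewrite addKn epsW /T -natr1; lra.
Qed.

Lemma discrete_line_word_occurs (m k p q a : nat) : (0 < m)%N -> (0 < q)%N ->
  exists n, forall i, (i < k)%N ->
    floor_mod m (f (n + i)%N) = (discrete_line p q a i %% m)%N.
Proof.
move=> m0 q0; have qR : 0 < q%:R :> R by rewrite ltr0n.
(* J samples, Q apart, gain at least rho * J * Q = m, while the error of the
   sample and the drift over the word stay below rho * J = 1 / q. *)
pose Q := (m * q)%N; pose J := (2 * (Q + k).+1)%N.
pose rho : R := (q%:R * J%:R)^-1.
have J0 : 0 < J%:R :> R by rewrite ltr0n.
have rho0 : 0 < rho by rewrite invr_gt0 mulr_gt0.
have rhoJ : rho * J%:R = q%:R^-1 by rewrite /rho invfM mulfVK ?gt_eqF.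
have [V window] := exists_slope_window (J * Q + k) rho0.
pose M := (Num.truncn V).+1; pose p' := (p + q * (m * M))%N.
have Vp' : V <= p'%:R / q%:R.
  rewrite ler_pdivlMr //; apply: (@le_trans _ _ (M%:R * q%:R)).
    by rewrite ler_wpM2r // ltW // truncnS_gt.
  by rewrite -natrM ler_nat /p'; nia.
have [n slope] := window _ Vp'.
have rise : m%:R <= rho * (J * Q)%:R.
  by rewrite natrM mulrA rhoJ /Q natrM mulrC mulfK ?gt_eqF.
have Qv : Q%:R * (p'%:R / q%:R) = (m * p')%:R :> R.
  by rewrite mulrA -natrM /Q mulnAC natrM mulfK ?gt_eqF.
have [|j jJ [z sample]] := exists_sample_mod (g := fun i => f (n + i)%N)
    (a%:R / q%:R) m0 (ltW rho0) Qv rise.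
  by move=> i iJ; rewrite telescope_addn slope // ltn_addr.
have jQi i : (i < k)%N -> (j * Q + i < J * Q + k)%N.
  by rewrite -leq_subLR; have := leq_mul jJ (leqnn Q); lia.
exists (n + j * Q)%N => i ik; rewrite -(floor_modBz _ _ z) /floor_mod.
rewrite (floor_near_line (g := fun i => f (n + j * Q + i)%N - m%:R * z%:~R)
  (p := p') (a := a) (k := k) (delta := 2 * rho * Q%:R) (eps := 2 * rho) q0) //.
- by rewrite modz_nat /p' discrete_line_slopeD // mulnCA -modnDmr modnMr addn0.
- by rewrite mulr_ge0 // ltW.
- by rewrite addn0.
- move=> l lk; have := slope _ (jQi l lk).
  by rewrite /telescope /= !addnS !addnA; lra.
- by rewrite -mulrDr -natrD -rhoJ mulrAC mulrC -!natrM ltr_pM2l // ltr_nat; lia.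
Qed.

Lemma cube_le_floor_mod_complexity (m k : nat) : (2 <= m)%N -> (0 < k)%N ->
  (k ^ 3 <= 1728 * subword_complexity m (fun n => floor_mod m (f n)) k)%N.
Proof.
move=> m2 k0; have m0 : (0 < m)%N by exact: ltnW.
pose u n := floor_mod m (f n); rewrite -/u.
have um n : (u n < m)%N by exact: floor_mod_lt.
have [->|k2] : k = 1%N \/ (2 <= k)%N by lia.
  by have := subword_complexity_gt0 1 um; lia.
have Kk : (k./2 + k./2 <= k)%N by lia.
have occ p q a : (p < q)%N -> exists n, forall i, (i < k)%N ->
    u (n + i)%N = (discrete_line p q a i %% m)%N.
  by move=> pq; apply: discrete_line_word_occurs => //; exact: leq_ltn_trans pq.
have := card_Farey_triples_leq_complexity m2 Kk um occ.
rewrite card_Farey_triples; have := sum_mul_totient_ge k./2.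
(* 1728 = 64 * 27 *)
have : (k ^ 3 <= (3 * k./2) ^ 3)%N by rewrite leq_exp2r //; lia.
by rewrite expnMn; lia.
Qed.

End SlowlyVaryingDifferences.

(** * Slightly convex sequences *)

Definition slightly_convex (R : numDomainType) (g : nat -> R) (k : nat) :
    Prop :=
  forall x y z, (x < y)%N -> (y < z)%N -> (z < k)%N ->
    0 <= (y - x)%:R * (g z - g y) - (z - y)%:R * (g y - g x) <= 1.

Lemma slightly_convex_telescope2 (R : realFieldType) (g : nat -> R) (k : nat)
    (eps : R) : eps * k%:R ^+ 3 <= 1 ->
  (forall i, (i < k)%N -> 0 <= telescope (telescope g) i <= eps) ->
  slightly_convex g k.
Proof.
move=> epsk d2g x y z xy yz zk.
have eps0 : 0 <= eps.
  by have /andP[] := d2g _ zk; exact: le_trans.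
have slope i j l : (i <= j)%N -> (j - i <= l)%N -> (j < k)%N ->
    0 <= telescope g j - telescope g i <= eps * l%:R.
  move=> ij jil jk; have /andP[lo hi] := increment_bounds (f := telescope g) ij
    (fun l il => d2g l (ltn_trans (proj2 (andP il)) jk)).
  rewrite mul0r in lo.
  by rewrite lo (le_trans hi) // ler_wpM2l // ler_nat.
set A : R := (y - x)%:R; set B : R := (z - y)%:R.
pose d := telescope g y.
have /andP[loA hiA] : (d - eps * A) * A <= g y - g x <= d * A.
  apply: increment_bounds => [|l /andP[xl ly]]; first exact: ltnW.
  have := slope l y (y - x)%N (ltnW ly) (leq_sub2l y xl) (ltn_trans yz zk).
  by rewrite -/A /d; lra.
have /andP[loB hiB] : d * B <= g z - g y <= (d + eps * B) * B.
  apply: increment_bounds => [|l /andP[yl lz]]; first exact: ltnW.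
  have := slope y l (z - y)%N yl (leq_sub2r y (ltnW lz)) (ltn_trans lz zk).
  by rewrite -/B /d; lra.
have ABk : A * B * (A + B) <= k%:R ^+ 3.
  by rewrite -natrD -!natrM -natrX ler_nat (expnSr k 2) !leq_mul; lia.
have A0 : 0 <= A by [].
have B0 : 0 <= B by [].
have := ler_wpM2l eps0 ABk.
have := ler_wpM2l B0 loA; have := ler_wpM2l B0 hiA.
have := ler_wpM2l A0 loB; have := ler_wpM2l A0 hiB.
by move: epsk; lra.
Qed.

Lemma slightly_convex_shift (R : numDomainType) (g : nat -> R) (i k : nat) :
  slightly_convex g (i + k) -> slightly_convex (fun d => g (i + d)%N - g i) k.
Proof.
move=> convex_g x y z xy yz zk.
have := convex_g (i + x) (i + y) (i + z); rewrite !ltn_add2l => /(_ xy yz zk).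
by rewrite !subnDl !opprB !addrA !subrK.
Qed.

Lemma slightly_convex_rev (R : realDomainType) (g : nat -> R) (i k : nat) :
  (i < k)%N -> slightly_convex g k ->
  slightly_convex (fun d => g (i - d)%N - g i) i.+1.
Proof.
move=> ik convex_g x y z xy yz zi.
have [zy yx xk] : [/\ i - z < i - y, i - y < i - x & i - x < k]%N by split; lia.
have := convex_g _ _ _ zy yx xk.
rewrite (_ : i - y - (i - z) = z - y)%N; last by lia.
rewrite (_ : i - x - (i - y) = y - x)%N; last by lia.
by lra.
Qed.

Lemma exists_first_max (d : Order.disp_t) (T : orderType d) (f : nat -> T)
    (n : nat) : (0 < n)%N ->
  exists2 e, (e < n)%N & forall i, (i < n)%N ->
    (f i <= f e)%O /\ ((i < e)%N -> (f i < f e)%O).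
Proof.
elim: n => [//|[_ _|n IH _]]; first by exists 0%N => // -[|//].
have [//|e en emax] := IH; have [le|lt] := leP (f n.+1) (f e).
  exists e; first exact: leqW.
  move=> i; rewrite ltnS leq_eqVlt => /predU1P[->|/emax//].
  by split=> //; rewrite ltnNge ltnW.
exists n.+1 => // i; rewrite ltnS leq_eqVlt => /predU1P[->|/emax[fi _]].
  by rewrite ltnn.
by split=> [|_]; [apply/ltW|]; exact: le_lt_trans lt.
Qed.

Lemma floorB_min_fract (R : archiRealFieldType) (x y : R) :
  y - (Num.floor y)%:~R <= x - (Num.floor x)%:~R ->
  Num.floor (x - y) = Num.floor x - Num.floor y.
Proof.
move=> yx; apply: floor_def; rewrite !intrD intrN.
by have := floor_itv x; have := floor_itv y; rewrite !intrD; move: yx; lra.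
Qed.

(* Before the first maximiser e of floor (h d) / d the maximum is not attained,
   which is why the numerator is lowered by one there: it turns the floor of
   d * v / e into its strict lower integer part. *)
Definition slope_word (e : nat) (v : int) (d : nat) : int :=
  ((d%:Z * v - (0 < d < e)%N%:Z) %/ e%:Z)%Z.

Lemma slope_word0 (e : nat) (v : int) : slope_word e v 0 = 0.
Proof. by rewrite /slope_word mul0r subr0 div0z. Qed.

Lemma slope_word_modz (m e : nat) (v : int) (d : nat) :
  (slope_word e (v %% (m * e)%N)%Z d = slope_word e v d %[mod m])%Z.
Proof.
have [->|e0] := posnP e; first by rewrite /slope_word !divz0.
rewrite {2}(divz_eq v (m * e)%N%:Z) /slope_word.
set x := (v %/ _)%Z; set w := (v %% _)%Z.
have -> : d%:Z * (x * (m * e)%N%:Z + w) - (0 < d < e)%N%:Z =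
   (d%:Z * x * m%:Z) * e%:Z + (d%:Z * w - (0 < d < e)%N%:Z).
  by rewrite PoszM; ring.
by rewrite divzMDl ?modzMDl // eqz_nat -lt0n.
Qed.

Section SlightlyConvexFloor.
Variables (R : archiRealFieldType) (h : nat -> R) (k : nat).
Hypotheses (h0 : h 0%N = 0) (convex_h : slightly_convex h k).

Lemma slightly_convex_cross (d e : nat) : (0 < d < e)%N -> (e < k)%N ->
  0 <= d%:R * h e - e%:R * h d <= 1.
Proof.
move=> /andP[d0 de] ek; have := convex_h d0 de ek.
by rewrite h0 subn0 natrB ?(ltnW de) //; lra.
Qed.

Lemma exists_first_max_slope : (1 < k)%N ->
  exists2 e, (0 < e < k)%N & forall d, (0 < d < k)%N ->
    Num.floor (h d) * e%:Z <= Num.floor (h e) * d%:Z - (d < e)%N%:Z.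
Proof.
move=> k1; pose F d : R := (Num.floor (h d.+1))%:~R / d.+1%:R.
have [|e ek emax] := @exists_first_max _ _ F k.-1; first by lia.
exists e.+1 => [|[//|d] dk]; first by lia.
have [|] := emax d; first by lia.
rewrite /F ler_pdivrMr // mulrAC ler_pdivlMr //.
rewrite ltr_pdivrMr // mulrAC ltr_pdivlMr //.
rewrite !pmulrn -!intrM ler_int ltr_int ltnS => le lt.
by case: ltnP => [/lt|_]; lia.
Qed.

Lemma floor_slightly_convex : (0 < k)%N ->
  exists2 e, (e < k)%N & forall d, (d < k)%N ->
    Num.floor (h d) = slope_word e (Num.floor (h e)) d.
Proof.
rewrite leq_eqVlt => /predU1P[<-|k1].
  by exists 0%N => // -[|//] _; rewrite slope_word0 h0 floor0.
have [e /andP[e0 ek] emax] := exists_first_max_slope k1.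
exists e => // -[_|d' dk]; first by rewrite slope_word0 h0 floor0.
set d := d'.+1 in dk *; have d0 : (0 < d)%N by [].
have eZ : 0 < e%:Z by [].
have := emax d; rewrite d0 dk => /(_ isT) max_d.
apply/le_anti/andP; split.
  by rewrite /slope_word d0 /= lez_divRL //; lia.
rewrite -ltzD1 /slope_word ltz_divLR // d0 /=.
rewrite -(ltr_int R) !(intrB, intrM, intrD) -!pmulrn.
have /andP[fe _] := floor_itv (h e); have /andP[_ fd] := floor_itv (h d).
rewrite intrD in fd.
have lo := ler_wpM2l (ler0n R d) fe.
have hi : e%:R * h d < e%:R * ((Num.floor (h d))%:~R + 1).
  by rewrite ltr_pM2l // ltr0n.
case: (ltngtP d e) => de /=.
- by have := @slightly_convex_cross d e; rewrite d0 de => /(_ isT ek); lra.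
- by have := @slightly_convex_cross e d; rewrite e0 de => /(_ isT dk); lra.
- by move: lo hi; rewrite -de; lra.
Qed.

End SlightlyConvexFloor.

Lemma slope_word_code (R : archiRealFieldType) (h : nat -> R) (m k n : nat) :
  (0 < m)%N -> (0 < k <= n)%N -> h 0%N = 0 -> slightly_convex h k ->
  exists ev : 'I_n * 'I_(m * n), forall d, (d < k)%N ->
    (Num.floor (h d) = slope_word ev.1 ev.2 d %[mod m])%Z.
Proof.
move=> m0 /andP[k0 kn] h0 convex_h.
have [e ek floor_h] := floor_slightly_convex h0 convex_h k0.
have en := leq_trans ek kn.
have [e0|e0] := posnP e.
  have mn0 : (0 < m * n)%N by rewrite muln_gt0 m0 (leq_ltn_trans _ en).
  exists (Ordinal en, Ordinal mn0) => d dk.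
  by rewrite floor_h // /slope_word /= e0 !divz0.
have v_lt : (floor_mod (m * e) (h e) < m * n)%N.
  apply: leq_trans (floor_mod_lt _ _) _; first by rewrite muln_gt0 m0.
  by rewrite leq_mul2l ltnW ?orbT.
exists (Ordinal en, Ordinal v_lt) => d dk.
by rewrite floor_h //= floor_modE ?muln_gt0 ?m0 // slope_word_modz.
Qed.

(* A code holds the index i1 of least fractional part, the floor there modulo m
   and the pairs (e, v) of the slope words before and after i1. *)
Definition word_code (m k : nat) : finType :=
  ('I_k * 'I_m * ('I_k * 'I_(m * k)) * ('I_k * 'I_(m * k)))%type.

Lemma card_word_code (m k : nat) : #|word_code m k| = (m ^ 3 * k ^ 5)%N.
Proof. by rewrite /word_code !card_prod !card_ord; ring. Qed.

(* One of the two truncated differences is 0, where slope_word vanishes. *)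
Definition decode_word (m k : nat) (x : word_code m k) (i : nat) : nat :=
  let: (i1, r, bwd, fwd) := x in
  `|((r%:Z + slope_word bwd.1 bwd.2 (i1 - i) +
      slope_word fwd.1 fwd.2 (i - i1)) %% m)%Z|%N.

(* At an index i1 of least fractional part, floors of differences g i - g i1 are
   differences of floors. *)
Lemma slightly_convex_word_code (R : archiRealFieldType) (g : nat -> R)
    (m k : nat) : (0 < m)%N -> (0 < k)%N -> slightly_convex g k ->
  exists x : word_code m k, forall i, (i < k)%N ->
    floor_mod m (g i) = decode_word x i.
Proof.
move=> m0 k0 convex_g; pose fract i := g i - (Num.floor (g i))%:~R.
have [i1 i1min] : exists i1 : 'I_k, forall i : 'I_k, fract i1 <= fract i.
  case: (arg_minP (P := xpredT) fract (i0 := Ordinal k0)) => // i1 _ min1.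
  by exists i1 => i; exact: min1.
have floorB i : (i < k)%N ->
    Num.floor (g i) = Num.floor (g i1) + Num.floor (g i - g i1).
  move=> ik; rewrite floorB_min_fract ?subrKC //.
  exact: (i1min (Ordinal ik)).
have convex_bwd := slightly_convex_rev (ltn_ord i1) convex_g.
have [||bwd hbwd] := slope_word_code (n := k) m0 _ _ convex_bwd.
- by rewrite ltn0Sn ltn_ord.
- by rewrite subn0 subrr.
have convex_fwd : slightly_convex (fun d => g (i1 + d)%N - g i1) (k - i1).
  by apply: slightly_convex_shift; rewrite subnKC // ltnW.
have [||fwd hfwd] := slope_word_code (n := k) m0 _ _ convex_fwd.
- by rewrite subn_gt0 ltn_ord leq_subr.
- by rewrite addn0 subrr.
exists (i1, Ordinal (floor_mod_lt (g i1) m0), bwd, fwd) => i ik /=.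
rewrite floor_modE // -addrA modzDml /floor_mod floorB //; congr absz.
apply/eqP; rewrite eqz_modDl; have [ii1|i1i] := leqP i i1.
  have iS : (i1 - i < i1.+1)%N by rewrite ltnS leq_subr.
  by have := hbwd _ iS; rewrite subKn // (eqP ii1) slope_word0 addr0 => ->.
have iB : (i - i1 < k - i1)%N by rewrite ltn_sub2r.
have := hfwd _ iB; rewrite subnKC 1?ltnW // (eqP (ltnW i1i)) slope_word0 add0r.
by move->.
Qed.

Lemma floor_mod_complexity_le (R : archiRealFieldType) (f : nat -> R)
    (m k N : nat) : (0 < m)%N -> (0 < k)%N ->
  (forall n, (N <= n)%N -> slightly_convex (fun i => f (n + i)%N) k) ->
  (subword_complexity m (fun n => floor_mod m (f n)) k <=
    N + m ^ 3 * k ^ 5)%N.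
Proof.
move=> m0 k0 convex_f; rewrite -card_word_code.
apply: subword_complexity_leq_card => // n Nn.
exact: slightly_convex_word_code (convex_f n Nn).
Qed.

(** * Powers *)

Lemma floor_pow_modE (R : realType) (c : R) (m : nat) :
  floor_pow_mod c m = fun n => floor_mod m (n%:R `^ c).
Proof.
apply/funext => n; rewrite /floor_pow_mod truncn_floor powR_ge0 /floor_mod.
have x0 : 0 <= Num.floor (n%:R `^ c : R) by rewrite floor_ge0 powR_ge0.
by rewrite -{2}(gez0_abs x0) modz_nat.
Qed.

Lemma powR_MVT (R : realType) (a x y : R) : 0 < x -> x <= y ->
  exists2 z, x <= z <= y & y `^ a - x `^ a = a * z `^ (a - 1) * (y - x).
Proof.
move=> x0 xy.
have dpow (z : R) : x <= z -> is_derive z 1 (@powR R ^~ a) (a * z `^ (a - 1)).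
  by move=> xz; apply: is_derive1_powR; apply: lt_le_trans xz.
have [||z] := @MVT_segment R (@powR R ^~ a) (fun z => a * z `^ (a - 1)) _ _ xy.
- by move=> z /[!in_itv]/= /andP[xz _]; apply: dpow; exact: ltW.
- apply: derivable_within_continuous => z /[!in_itv]/= /andP[xz _].
  by apply: ex_derive; exact: dpow.
- by rewrite in_itv /= => xzy ?; exists z.
Qed.

Lemma telescope_powR_bounds (R : realType) (c : R) (n : nat) :
  1 <= c -> (0 < n)%N ->
  c * n%:R `^ (c - 1) <= telescope (fun i => i%:R `^ c) n
    <= c * n.+1%:R `^ (c - 1).
Proof.
move=> c1 n0; have n0R : 0 < n%:R :> R by rewrite ltr0n.
have [|z /andP[nz zn]] := powR_MVT c n0R (_ : n%:R <= n.+1%:R).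
  by rewrite ler_nat.
rewrite /telescope /= => ->; have z0 := lt_le_trans n0R nz.
rewrite -natr1 addrAC subrr add0r mulr1.
by rewrite !ler_wpM2l ?ge0_ler_powR ?nnegrE //; lra.
Qed.

Lemma telescope2_powR_bounds (R : realType) (c : R) (n : nat) :
  1 <= c -> c <= 2 -> (0 < n)%N ->
  0 <= telescope (telescope (fun i => i%:R `^ c)) n <= 4 / n%:R `^ (2 - c).
Proof.
move=> c1 c2 n0; have n0R : 0 < n%:R :> R by rewrite ltr0n.
have /andP[lo hi] := telescope_powR_bounds c1 n0.
have /andP[loS hiS] := telescope_powR_bounds c1 (ltn0Sn n).
rewrite ![telescope (telescope _) _]/telescope /= subr_ge0.
rewrite (le_trans hi loS) /=; apply: le_trans (lerB hiS lo) _.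
have [|z /andP[nz _]] := powR_MVT (c - 1) n0R (_ : n%:R <= n.+2%:R).
  by rewrite ler_nat; lia.
have -> : n.+2%:R - n%:R = 2 :> R by rewrite -addn2 natrD addrAC subrr add0r.
rewrite -mulrBr => ->; rewrite (_ : c - 1 - 1 = - (2 - c)) ?powRN; last by ring.
have z0 := lt_le_trans n0R nz.
have zn : (z `^ (2 - c))^-1 <= (n%:R `^ (2 - c))^-1.
  rewrite lef_pV2 ?posrE ?powR_gt0 //.
  by rewrite ge0_ler_powR ?nnegrE ?subr_ge0 // ltW.
have w0 : 0 <= (z `^ (2 - c))^-1 by rewrite invr_ge0 powR_ge0.
move: zn w0; move: (z `^ _)^-1 (n%:R `^ _)^-1 => w w' ww' w0.
have : c * (c - 1) * w <= 2 * w by rewrite ler_wpM2r //; nra.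
by lra.
Qed.

Lemma le_powR_of_root (R : realType) (a x y : R) : 0 < a -> 0 <= x ->
  x `^ a^-1 <= y -> x <= y `^ a.
Proof.
move=> a0 x0 xy; have y0 : 0 <= y by rewrite (le_trans _ xy) ?powR_ge0.
have -> : x = (x `^ a^-1) `^ a by rewrite -powRrM mulVf ?gt_eqF // powRr1.
by rewrite ge0_ler_powR ?nnegrE ?powR_ge0 // ltW.
Qed.

Lemma cvgry_natr_powR (R : realType) (a : R) : 0 < a ->
  (n%:R `^ a @[n --> \oo] --> +oo)%classic.
Proof.
move=> a0; apply/cvgryPge => A; near=> n.
apply: (@le_trans _ _ (Num.max A 0)); first by rewrite le_max lexx.
apply: le_powR_of_root => //; first by rewrite le_max lexx orbT.
by near: n; exact: nbhs_infty_ger.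
Unshelve. all: by end_near.
Qed.

Lemma telescope_powR_cvgy (R : realType) (c : R) : 1 < c ->
  (telescope (fun i => i%:R `^ c : R) n @[n --> \oo] --> +oo)%classic.
Proof.
move=> c1; apply/cvgryPge => A.
have c10 : 0 < c - 1 by lra.
near=> n; have n0 : (0 < n)%N by near: n; exact: nbhs_infty_gt.
have /andP[+ _] := telescope_powR_bounds (ltW c1) n0; apply: le_trans.
apply: (@le_trans _ _ (n%:R `^ (c - 1))); last first.
  by rewrite ler_peMl ?powR_ge0 // ltW.
by near: n; move/cvgryPge: (cvgry_natr_powR c10); exact.
Unshelve. all: by end_near.
Qed.

Lemma telescope2_powR_cvg0 (R : realType) (c : R) : 1 <= c -> c < 2 ->
  (telescope (telescope (fun i => i%:R `^ c : R)) n @[n --> \oo] --> 0)%classic.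
Proof.
move=> c1 c2; have c20 : 0 < 2 - c by lra.
apply/cvgr0Pnorm_le => eps eps0; near=> n.
have n0 : (0 < n)%N by near: n; exact: nbhs_infty_gt.
have /andP[ge0 le] := telescope2_powR_bounds c1 (ltW c2) n0.
rewrite ger0_norm // (le_trans le) // ler_pdivrMr ?powR_gt0 ?ltr0n //.
rewrite mulrC -ler_pdivrMr //.
by near: n; move/cvgryPge: (cvgry_natr_powR c20); exact.
Unshelve. all: by end_near.
Qed.

Lemma powR_slightly_convex (R : realType) (c : R) (k n : nat) :
  1 <= c -> c < 2 -> (0 < n)%N -> (4 * k%:R ^+ 3) `^ (2 - c)^-1 <= n%:R ->
  slightly_convex (fun i => (n + i)%:R `^ c) k.
Proof.
move=> c1 c2 n0 nX; have c20 : 0 < 2 - c by lra.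
have npow : 0 < n%:R `^ (2 - c) by rewrite powR_gt0 ?ltr0n.
apply: (@slightly_convex_telescope2 _ _ _ (4 / n%:R `^ (2 - c))).
  by rewrite mulrAC ler_pdivrMr // mul1r le_powR_of_root ?mulr_ge0 ?exprn_ge0.
move=> i _.
rewrite (telescope_addn (fun j => j%:R `^ c)) telescope_addn.
have /andP[-> /=] := telescope2_powR_bounds c1 (ltW c2) (ltn_addr i n0).
move=> /le_trans; apply.
rewrite ler_wpM2l // lef_pV2 ?posrE ?powR_gt0 ?ltr0n ?addn_gt0 ?n0 //.
by rewrite ge0_ler_powR ?nnegrE ?(ltW c20) // ler_nat leq_addr.
Qed.

Lemma floor_powR_complexity_le (R : realType) (c : R) (m k : nat) :
  1 <= c -> c < 2 -> (0 < m)%N -> (0 < k)%N ->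
  (subword_complexity m (fun n => floor_mod m (n%:R `^ c : R)) k <=
    (Num.truncn ((4 * k%:R ^+ 3 : R) `^ (2 - c)^-1)).+1 + m ^ 3 * k ^ 5)%N.
Proof.
move=> c1 c2 m0 k0; apply: floor_mod_complexity_le => // n Xn.
apply: powR_slightly_convex => //; first by exact: leq_ltn_trans Xn.
by rewrite ltW // (lt_le_trans (truncnS_gt _)) // ler_nat.
Qed.

Lemma floor_powR_complexity_le_powR (R : realType) (c r : R) (m k : nat) :
  1 <= c -> c < 2 -> (0 < m)%N -> (0 < k)%N -> 3 / (2 - c) <= r -> 5 <= r ->
  (subword_complexity m (fun n => floor_mod m (n%:R `^ c : R)) k)%:R
    <= (4 `^ (2 - c)^-1 + 1 + m%:R ^+ 3) * k%:R `^ r.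
Proof.
move=> c1 c2 m0 k0 r3 r5; have c20 : 0 < 2 - c by lra.
have kR : 1 <= k%:R :> R by rewrite ler1n.
have := floor_powR_complexity_le c1 c2 m0 k0; rewrite -(ler_nat R).
move=> /le_trans; apply.
rewrite natrD -natr1 natrM !natrX !(mulrDl _ _ (_ `^ r)) mul1r.
have k_pow n : n%:R <= r -> k%:R ^+ n <= k%:R `^ r.
  by move=> nr; rewrite -powR_mulrn // ler_powR.
apply: lerD; first apply: lerD.
- apply: (@le_trans _ _ ((4 * k%:R ^+ 3) `^ (2 - c)^-1)).
    by rewrite truncn_le powR_ge0.
  rewrite powRM ?exprn_ge0 // ler_wpM2l ?powR_ge0 //.
  by rewrite -powR_mulrn // -powRrM ler_powR.
- by apply: (k_pow 0%N); lra.
- by rewrite ler_wpM2l ?exprn_ge0 // k_pow.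
Qed.

Theorem theorem3 (R : realType) (c : R) (m : nat)
    (hc1 : 1 < c) (hc2 : c < 2) (hm : (2 <= m)%N) :
  (forall r : R, Num.max (4 / (2 - c)) 6 < r ->
     exists C1 : R, forall k : nat, (1 <= k)%N ->
       ((subword_complexity m (floor_pow_mod c m) k)%:R : R) <= C1 * (k%:R `^ r))
  /\
  (exists C2 : R, 0 < C2 /\ forall k : nat, (1 <= k)%N ->
       C2 * (k%:R ^+ 3) <= ((subword_complexity m (floor_pow_mod c m) k)%:R : R)).
Proof.
rewrite floor_pow_modE; split=> [r|].
  rewrite gt_max => /andP[r4 r6].
  exists (4 `^ (2 - c)^-1 + 1 + m%:R ^+ 3) => k k0.
  apply: (floor_powR_complexity_le_powR (ltW hc1) hc2 (ltnW hm) k0).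
    apply: le_trans (ltW r4).
    by rewrite ler_wpM2r ?invr_ge0 ?subr_ge0 ?(ltW hc2) ?ler_nat.
  by lra.
exists 1728^-1; split=> [|k k0]; first by rewrite invr_gt0.
rewrite ler_pdivrMl // -natrX -natrM ler_nat.
apply: cube_le_floor_mod_complexity => //.
  exact: telescope_powR_cvgy.
by apply: telescope2_powR_cvg0 => //; exact: ltW.
Qed.
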